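(* The proved and best-known small values $f(2)=6$, $f(3)=11$, $f(4)\le 21$, $f(5)\le 41$ all equal $5\cdot 2^{d-2}+1$, suggesting this as a closed form for $f(d)$. It fails from $d=7$: the lifting inequality $f(r+3)\le 6\cdot 2^r+3f(r)$ gives $f(7)\le 6\cdot 2^4+3\cdot 21=159<161=5\cdot 2^5+1$, and asymptotically $f(d)\le 1.2\cdot 2^d$ beats $1.25\cdot 2^d$. The closed form remains the best known value for $d\le 6$.
   Context: Write $[3]=\{0,1,2\}$. A proper sub-box of $[3]^d$ is a set $B=S_1\times\dots\times S_d$ with $\varnothing\neq S_i\subsetneq[3]$ for every $1\le i\le d$ (so each side $S_i$ has one or two elements). A double cover of $[3]^d$ is a finite multiset $\{B_1,\dots,B_m\}$ of proper sub-boxes such that every point of $[3]^d$ lies in exactly two of the $B_j$, counted with multiplicity; its size is $m$. $f(d)$ denotes the minimum size of a double cover of $[3]^d$. The lifting inequality (''leapfrog lift'') $f(r+3)\le 6\cdot 2^r+3f(r)$ holds for all $r\ge 0$; iterating it gives $f(d)\le(\tfrac65+o(1))2^d$, which is the precise form of the asymptotic bound in the claim. ''Best known'' refers to the smallest size of a double cover known at the time of the paper. *)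

(* Defs.v *)
From mathcomp Require Import all_boot.

Set Implicit Arguments.
Unset Strict Implicit.
Unset Printing Implicit Defensive.

Definition point (d : nat) : finType := {ffun 'I_d -> 'I_3}.

Definition box (d : nat) (S : {ffun 'I_d -> {set 'I_3}}) : {set point d} :=
  [set x : point d | [forall i, x i \in S i]].

Definition proper_box (d : nat) (B : {set point d}) : bool :=
  [exists S : {ffun 'I_d -> {set 'I_3}},
     [forall i, (S i != set0) && (S i \proper [set: 'I_3])] && (B == box S)].

(* Finite multisets of boxes are represented by sequences: repetitions count,
   and the order of the sequence is irrelevant to both conditions. *)
Definition double_cover (d : nat) (s : seq {set point d}) : bool :=
  all (@proper_box d) s &&
  [forall x : point d, count (fun B : {set point d} => x \in B) s == 2].

Definition has_double_cover (d m : nat) : bool :=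
  [exists t : m.-tuple {set point d}, double_cover t].

(* Witness: two copies of the partition of [3]^d into the 2^d products of the
   sides {0,1} and {2}. *)
Lemma has_double_cover_ex (d : nat) : exists m, has_double_cover d m.
Proof.
pose side (c : bool) : {set 'I_3} :=
  if c then [set ord_max] else ~: [set ord_max].
pose sides (b : {ffun 'I_d -> bool}) := [ffun i : 'I_d => side (b i)].
pose s := [seq box (sides b) | b <- enum {ffun 'I_d -> bool}].
exists (size (s ++ s)); apply/existsP; exists (in_tuple (s ++ s)).
rewrite /double_cover /= all_cat andbb; apply/andP; split.
  apply/allP => _ /mapP[b _ ->]; apply/existsP; exists (sides b).
  rewrite eqxx andbT; apply/forallP => i; rewrite ffunE properE subsetT /=.
  have n02 : (ord0 : 'I_3) != ord_max by [].
  apply/andP; split.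
    apply/set0Pn; case: (b i); first by exists ord_max; rewrite !inE.
    by exists ord0; rewrite !inE.
  apply/subsetPn; case: (b i); first by exists ord0; rewrite !inE.
  by exists ord_max; rewrite !inE ?negbK.
apply/forallP => x; rewrite count_cat.
suff -> : count (fun B : {set point d} => x \in B) s = 1 by [].
pose bx : {ffun 'I_d -> bool} := [ffun i => x i == ord_max].
have Hb (b : {ffun 'I_d -> bool}) : (x \in box (sides b)) = (b == bx).
  rewrite inE; apply/forallP/eqP => [Hx|-> i].
    apply/ffunP => i; have := Hx i; rewrite !ffunE /side.
    case: (b i); rewrite !inE; first by move->.
    by move/negbTE->.
  by rewrite !ffunE /side; case: ifP => h; rewrite !inE h.
rewrite count_map (eq_count Hb).
by rewrite count_uniq_mem ?enum_uniq // mem_enum.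
Qed.

Definition f (d : nat) : nat := ex_minn (has_double_cover_ex d).

(* The subtraction is truncated, so this is the intended value for d >= 2. *)
Definition closed_form (d : nat) : nat := 5 * 2 ^ (d - 2) + 1.

(* Main.v *)
(* Upper bounds.  Suppose every point of [3]^a lies either in exactly two boxes
   of a family P and in none of Q, or in none of P and in exactly one of Q.
   Multiplying the boxes of P by the 2^r boxes of a partition of [3]^r and those
   of Q by a minimal double cover of [3]^r gives
   f(r + a) <= |P| 2^r + |Q| f(r).  Taking |P| = 6, |Q| = 3 for a = 3 is the
   leapfrog lift; |P| = 4, |Q| = 1 for a = 2 gives f(2) and f(3); an explicit
   double cover gives f(5).

   Lower bounds.  The slice of a double cover at a value of the i-th coordinate
   is a double cover of [3]^d, so that at most 2m - 3 f(d) of the m boxes have a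
   one-element side in direction i.  With few one-element sides, m is too small
   for the total volume 2 * 3^(d+1) of the boxes.  This gives f(3) >= 11, and for
   d + 1 = 2 it leaves the case m = 5 without one-element sides in some
   direction; there the boxes missing a given value project to a partition of
   [3], so that there are at least two of them for each of the three values. *)
Require Import Defs.
From mathcomp Require Import all_boot zify.

Set Implicit Arguments.
Unset Strict Implicit.
Unset Printing Implicit Defensive.

Local Notation sides_of d := {ffun 'I_d -> {set 'I_3}}.

(** * Covers described by the sides of their boxes *)

Definition proper_side (A : {set 'I_3}) : bool := (A != set0) && (A != setT).

Definition proper_sides d (S : sides_of d) : bool :=
  [forall i, proper_side (S i)].

Definition cover_mult d (T : seq (sides_of d)) (x : point d) : nat :=
  count (fun S => x \in box S) T.

(** Side families replace boxes so that the sides stay accessible. The multiplicity [k] is free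
    because partitions ([k = 1]) are used besides double covers. *)
Definition covers d (k : nat) (T : seq (sides_of d)) : Prop :=
  all (@proper_sides d) T /\ forall x, cover_mult T x = k.

Lemma f_le d (T : seq (sides_of d)) : covers 2 T -> f d <= size T.
Proof.
case=> Tproper Tcount; rewrite /f; case: ex_minnP => m _ min_m; apply: min_m.
rewrite -(size_map (@box d)); apply/existsP; exists (in_tuple (map (@box d) T)).
apply/andP; split.
  rewrite all_map; apply: sub_all Tproper => S /forallP S_proper.
  apply/existsP; exists S; rewrite eqxx andbT; apply/forallP => i.
  by rewrite properT; apply: S_proper.
by apply/forallP => x; rewrite count_map; apply/eqP/Tcount.
Qed.

Lemma f_witness d :
  exists2 T : seq (sides_of d), covers 2 T & size T = f d.
Proof.
rewrite /f; case: ex_minnP => m /existsP[t /andP[tproper /forallP tcount]] _.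
have [T [Tproper eqT]] : exists T : seq (sides_of d),
    all (@proper_sides d) T /\ map (@box d) T = t.
  elim: (val t) tproper => [_|B s IHs /= /andP[/existsP[S /andP[S_proper /eqP ->]]]].
    by exists [::].
  case/IHs=> T [Tproper eqT]; exists (S :: T); rewrite /= Tproper eqT andbT.
  by split=> //; apply/forallP => i; have := forallP S_proper i; rewrite properT.
exists T; last by rewrite -(size_map (@box d)) eqT size_tuple.
by split=> // x; have /eqP := tcount x; rewrite -eqT count_map.
Qed.

(** The boxes are the products of the sides {0} and {1,2}; a point lies only in the one recording
    which of its coordinates are 0. *)
Lemma exists_partition d :
  exists2 T : seq (sides_of d), covers 1 T & size T = 2 ^ d.
Proof.
pose side (c : bool) : {set 'I_3} := [set v | (v == ord0) == c].
pose sides (b : {ffun 'I_d -> bool}) := [ffun i => side (b i)].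
exists (map sides (enum {ffun 'I_d -> bool})); last first.
  by rewrite size_map -cardT card_ffun card_bool card_ord.
split=> [|x].
  apply/allP => _ /mapP[b _ ->]; apply/forallP => i; rewrite ffunE.
  apply/andP; split; last first.
    apply/negP => /eqP/setP/(_ (if b i then ord_max else ord0)).
    by rewrite !inE; case: (b i).
  apply/set0Pn; exists (if b i then ord0 else ord_max).
  by rewrite inE; case: (b i).
pose bx : {ffun 'I_d -> bool} := [ffun i => x i == ord0].
rewrite /cover_mult count_map (eq_count (a2 := pred1 bx)) => [|b /=].
  by rewrite count_uniq_mem ?enum_uniq // mem_enum.
rewrite inE; apply/forallP/eqP => [xb|-> i]; last by rewrite !ffunE inE.
by apply/ffunP => i; have := xb i; rewrite !ffunE inE => /eqP.
Qed.

(* A side is encoded by a number whose bit of rank [v] tells whether [v]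
   belongs to it, and a box by the list of its sides. *)
Definition in_side (n v : nat) : bool := odd (n %/ 2 ^ v).

Definition in_word (w x : seq nat) : bool := all2 in_side w x.

Fixpoint words (A : seq nat) (d : nat) : seq (seq nat) :=
  if d is d'.+1 then [seq a :: w | a <- A, w <- words A d'] else [:: [::]].

Definition word_sides d (w : seq nat) : sides_of d :=
  [ffun i : 'I_d => [set v : 'I_3 | in_side (nth 0 w i) v]].

Lemma mem_words (A : seq nat) d (w : seq nat) :
  (w \in words A d) = (size w == d) && all (mem A) w.
Proof.
elim: d w => [|d IHd] [|a w] //=.
  by apply/negP => /allpairsP[[? ?] [_ _]].
rewrite eqSS andbCA -IHd; apply/allpairsP/andP => [[[b u] /= [bA uA [-> ->]]]|[aA wA]].
  by [].
by exists (a, w).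
Qed.

Definition point_word d (x : point d) : seq nat := [seq val (x i) | i : 'I_d].

Lemma size_point_word d (x : point d) : size (point_word x) = d.
Proof. by rewrite size_image card_ord. Qed.

Lemma nth_point_word d (x : point d) (i : 'I_d) : nth 0 (point_word x) i = x i.
Proof. by rewrite (nth_map i) ?size_enum_ord ?nth_ord_enum. Qed.

Lemma point_wordP d (x : point d) : point_word x \in words (iota 0 3) d.
Proof.
rewrite mem_words size_point_word eqxx /=.
by apply/allP => _ /mapP[i _ ->]; case: (x i) => -[|[|[|]]].
Qed.

Lemma in_word_sides d (w : seq nat) (x : point d) : size w = d ->
  (x \in box (word_sides d w)) = in_word w (point_word x).
Proof.
move=> sz_w; rewrite inE /in_word all2E size_point_word sz_w eqxx /=.
have sz_zip : size (zip w (point_word x)) = d.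
  by rewrite size_zip size_point_word sz_w minnn.
have nth_wx (i : 'I_d) : nth (0, 0) (zip w (point_word x)) i = (nth 0 w i, val (x i)).
  by rewrite nth_zip ?size_point_word // nth_point_word.
apply/forallP/(all_nthP (0, 0)) => [xw i | xw i].
  rewrite sz_zip => lt_id; have := xw (Ordinal lt_id).
  by have /= -> := nth_wx (Ordinal lt_id); rewrite ffunE inE.
by rewrite ffunE inE; have := xw i; rewrite sz_zip ltn_ord nth_wx; apply.
Qed.

(** Of the codes 0 to 7, only 0 (empty) and 7 (full) are improper. *)
Lemma word_sides_proper d (w : seq nat) :
  w \in words (iota 1 6) d -> proper_sides (word_sides d w).
Proof.
rewrite mem_words => /andP[/eqP sz_w /all_nthP w_proper]; apply/forallP => i.
have := w_proper 0 i; rewrite sz_w ltn_ord => /(_ isT).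
rewrite ffunE inE; move: (nth 0 w i) => n.
rewrite !inE => n_proper; apply/andP; split.
  (* The least element of the side; below, the least value missing from it. *)
  apply/set0Pn; exists (inord (if odd n then 0 else if odd (n %/ 2) then 1 else 2)).
  rewrite inE inordK; last by case: ifP => // _; case: ifP.
  by move: n_proper; do !case/orP; move/eqP->.
apply/negP => /eqP/setP/(_ (inord (if ~~ odd n then 0 else
  if ~~ odd (n %/ 2) then 1 else 2))).
rewrite !inE inordK; last by case: ifP => // _; case: ifP.
by move: n_proper; do !case/orP; move/eqP->.
Qed.

(** * Lifting schemes *)

(** Over the naturals, the equation forces the two counts to be (2, 0) or (0, 1). Being boolean, it
    is checked by computation. *)
Definition lift_scheme (a : nat) (P Q : seq (seq nat)) : bool :=
  [&& all (mem (words (iota 1 6) a)) (P ++ Q) &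
      all (fun x => count (in_word^~ x) P + 2 * count (in_word^~ x) Q == 2)
        (words (iota 0 3) a)].

Definition join_sides r a (S : sides_of r) (S' : sides_of a) : sides_of (r + a) :=
  [ffun i => match split i with inl j => S j | inr j => S' j end].

Lemma in_join_sides r a (S : sides_of r) (S' : sides_of a) (x : point (r + a)) :
  (x \in box (join_sides S S')) =
  ([ffun i => x (lshift a i)] \in box S) && ([ffun i => x (rshift r i)] \in box S').
Proof.
rewrite !inE; apply/forallP/andP => [xS | [/forallP xS /forallP xS'] i].
  split; apply/forallP => i; rewrite ffunE.
    by have := xS (lshift a i); rewrite ffunE (unsplitK (inl i)).
  by have := xS (rshift r i); rewrite ffunE (unsplitK (inr i)).
rewrite ffunE; case: split_ordP => j ->.
  by have := xS j; rewrite ffunE.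
by have := xS' j; rewrite ffunE.
Qed.

Lemma join_sides_proper r a (S : sides_of r) (S' : sides_of a) :
  proper_sides S -> proper_sides S' -> proper_sides (join_sides S S').
Proof.
move=> /forallP Sp /forallP S'p; apply/forallP => i; rewrite ffunE.
by case: split.
Qed.

Lemma cover_mult_join r a (T : seq (sides_of r))
    (T' : seq (sides_of a)) (x : point (r + a)) :
  cover_mult [seq join_sides U V | U <- T, V <- T'] x =
  cover_mult T [ffun i => x (lshift a i)] *
  cover_mult T' [ffun i => x (rshift r i)].
Proof.
rewrite /cover_mult; elim: T => //= S T IHT; rewrite count_cat IHT mulnDl; congr (_ + _).
rewrite count_map (eq_count (in_join_sides _ ^~ _ : _ =1 fun _ => _)).
by case: (_ \in _) => /=; rewrite ?mul1n ?mul0n ?count_pred0.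
Qed.

Lemma f_lift a P Q r : lift_scheme a P Q ->
  f (r + a) <= size P * 2 ^ r + size Q * f r.
Proof.
case/andP=> PQ_proper /allP PQ_count.
have [T [T_proper T_count] <-] := exists_partition r.
have [D [D_proper D_count] <-] := f_witness r.
pose L := [seq join_sides U V | U <- T, V <- map (word_sides a) P] ++
          [seq join_sides U V | U <- D, V <- map (word_sides a) Q].
have -> : size P * size T + size Q * size D = size L.
  by rewrite size_cat !size_allpairs !size_map ![_ * size (_ : seq {ffun _ -> _})]mulnC.
have sz_PQ w : w \in P ++ Q -> size w = a.
  by move/(allP PQ_proper); rewrite /= mem_words => /andP[/eqP].
have sides_proper w : w \in P ++ Q -> proper_sides (word_sides a w).
  by move/(allP PQ_proper); apply: word_sides_proper.
have count_sides U (y : point a) : {subset U <= P ++ Q} ->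
    cover_mult (map (word_sides a) U) y = count (in_word^~ (point_word y)) U.
  move=> sub_U; rewrite /cover_mult count_map; apply: eq_in_count => w wU /=.
  by rewrite in_word_sides // sz_PQ ?sub_U.
apply: f_le; split=> [|x].
  rewrite all_cat; apply/andP; split.
    apply/allP => _ /allpairsP[[S S'] /= [ST /mapP[w wP ->] ->]].
    apply: join_sides_proper; [exact: (allP T_proper) |].
    by rewrite sides_proper // mem_cat wP.
  apply/allP => _ /allpairsP[[S S'] /= [SD /mapP[w wQ ->] ->]].
  apply: join_sides_proper; [exact: (allP D_proper) |].
  by rewrite sides_proper // mem_cat wQ orbT.
(* [P] is multiplied by a cover of multiplicity 1 and [Q] by one of multiplicity 2, which gives the
   left side of the scheme equation. *)
rewrite /cover_mult count_cat -!/(cover_mult _ _) !cover_mult_join.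
rewrite T_count D_count mul1n !count_sides.
- exact/eqP/PQ_count/point_wordP.
- by move=> w wQ; rewrite mem_cat wQ orbT.
- by move=> w wP; rewrite mem_cat wP.
Qed.

(** * Upper bounds *)

Lemma f0_le : f 0 <= 2.
Proof. exact: (@f_lift 0 [:: [::]; [::]] [::] 0 isT). Qed.

(** The codes 3, 5, 6 are the two-element sides; each value lies in two of them. *)
Lemma f1_le : f 1 <= 3.
Proof. exact: (@f_lift 1 [:: [:: 3]; [:: 5]; [:: 6]] [::] 0 isT). Qed.

(** The four boxes of [P] cover twice every point of [3]^2 except (0,0), which is left to {0} x
    {0}. *)
Lemma f_lift2 r : f (r + 2) <= 4 * 2 ^ r + f r.
Proof.
rewrite -[f r]mul1n.
exact: (@f_lift 2 [:: [:: 3; 6]; [:: 5; 6]; [:: 6; 3]; [:: 6; 5]] [:: [:: 1; 1]]).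
Qed.

(* The six boxes of [P] are the products of the sides [3] minus sigma(i), for
   the permutations sigma of [3]: they cover twice every point of [3]^3 off
   the diagonal. *)
Lemma f_leapfrog r : f (r + 3) <= 6 * 2 ^ r + 3 * f r.
Proof.
pose P := permutations [:: 3; 5; 6].
exact: (@f_lift 3 P [:: [:: 1; 1; 1]; [:: 2; 2; 2]; [:: 4; 4; 4]]).
Qed.

(* Found by a computer search among the covers invariant under an involution
   of [3]^5. *)
Definition cover5 : seq (seq nat) :=
  [:: [:: 3; 5; 2; 6; 5]; [:: 5; 5; 6; 6; 6]; [:: 5; 3; 5; 4; 3]; [:: 2; 1; 6; 6; 2];
    [:: 4; 4; 3; 6; 1]; [:: 1; 6; 2; 1; 6]; [:: 2; 1; 5; 3; 2]; [:: 4; 4; 5; 5; 1];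
    [:: 6; 6; 2; 3; 6]; [:: 5; 3; 5; 3; 3]; [:: 5; 1; 2; 1; 2]; [:: 5; 5; 1; 6; 6];
    [:: 4; 4; 5; 3; 1]; [:: 2; 6; 2; 1; 3]; [:: 2; 1; 3; 6; 2]; [:: 3; 1; 2; 1; 2];
    [:: 1; 2; 5; 3; 4]; [:: 6; 1; 2; 1; 2]; [:: 6; 6; 6; 4; 6]; [:: 3; 6; 6; 6; 3];
    [:: 6; 3; 6; 1; 5]; [:: 1; 3; 2; 1; 5]; [:: 3; 5; 5; 3; 5]; [:: 5; 5; 5; 1; 6];
    [:: 1; 2; 3; 6; 4]; [:: 2; 5; 2; 1; 5]; [:: 5; 6; 2; 1; 3]; [:: 5; 3; 2; 6; 3];
    [:: 6; 6; 1; 4; 6]; [:: 2; 1; 5; 5; 2]; [:: 5; 5; 2; 1; 5]; [:: 4; 4; 6; 6; 1];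
    [:: 6; 3; 6; 6; 5]; [:: 6; 3; 1; 4; 5]; [:: 3; 6; 5; 1; 3]; [:: 1; 2; 6; 6; 4];
    [:: 6; 6; 5; 3; 6]; [:: 6; 3; 1; 3; 5]; [:: 1; 2; 5; 5; 4]; [:: 3; 5; 5; 4; 5];
    [:: 3; 6; 1; 6; 3]].

Lemma f5_le : f 5 <= 41.
Proof.
have cover5P : lift_scheme 5 cover5 [::] by vm_compute.
(* For [r = 0] and empty [Q], the lift bound is the size of [cover5]. *)
exact: leq_trans (f_lift 0 cover5P) _.
Qed.

Lemma f4_le : f 4 <= 21.
Proof. by have : f 4 <= _ := f_leapfrog 1; have := f1_le; lia. Qed.

Lemma f6_le : f 6 <= 81.
Proof.
have : f 6 <= _ := f_leapfrog 3; have : f 3 <= _ := f_lift2 1.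
by have := f1_le; lia.
Qed.

(** From [f r <= 5 * 2 ^ (r - 2) + 1] the leapfrog gives [f (r + 3) <= 39 * 2 ^ (r - 2) + 3], less
    than [40 * 2 ^ (r - 2) + 1] once [r >= 4]. Steps of three require the base cases 7, 8, 9. *)
Lemma f_lt_closed_form d : 7 <= d -> f d < closed_form d.
Proof.
rewrite /closed_form; elim/ltn_ind: d => d IHd le7d.
have [lt_d10|le10d] := ltnP d 10.
  have : d \in [:: 7; 8; 9] by rewrite !inE; lia.
  rewrite !inE; do 2?case/orP; move/eqP->.
  - rewrite -[5 * _ + 1]/161; by have : f 7 <= _ := f_leapfrog 4; have := f4_le; lia.
  - rewrite -[5 * _ + 1]/321; by have : f 8 <= _ := f_leapfrog 5; have := f5_le; lia.
  - rewrite -[5 * _ + 1]/641; by have : f 9 <= _ := f_leapfrog 6; have := f6_le; lia.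
have := IHd (d - 3) ltac:(lia) ltac:(lia); have := f_leapfrog (d - 3).
have -> : d - 3 + 3 = d by lia.
have [e ->] : exists e, d = e + 6 by exists (d - 6); lia.
have -> : e + 6 - 2 = e.+4 by lia.
have -> : e + 6 - 3 = e.+3 by lia.
rewrite subn2 /= !expnS; have := expn_gt0 2 e; lia.
Qed.

(** * Double counting of sides and volume *)

(** The additive form avoids truncated subtraction and can be summed over the boxes. *)
Lemma card_proper_side (A : {set 'I_3}) : proper_side A -> #|A| + (#|A| == 1) = 2.
Proof.
case/andP; rewrite -card_gt0 -properT => A_gt0 /proper_card.
by rewrite cardsT card_ord; case: #|A| A_gt0 => [|[|[|]]].
Qed.

Lemma card_setC_proper_side (A : {set 'I_3}) :
  proper_side A -> #|A| != 1 -> #|~: A| = 1.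
Proof.
move/card_proper_side; have := cardsC A; rewrite card_ord.
by case: #|A| => [|[|[|n]]] //= [].
Qed.

Lemma count_sum (U : Type) (a : pred U) (s : seq U) : count a s = \sum_(x <- s) a x.
Proof. by rewrite -sum1_count big_mkcond. Qed.

Lemma sum_count_side d (P : pred (sides_of d)) (i : 'I_d) (T : seq (sides_of d)) :
  \sum_(v : 'I_3) count (fun S : sides_of d => (v \in S i) && P S) T =
  \sum_(S <- T | P S) #|S i|.
Proof.
under [LHS]eq_bigr => v _ do rewrite count_sum.
rewrite exchange_big [RHS]big_mkcond; apply: eq_bigr => S _ /=.
case: (P S); last by rewrite big1 // => v _; rewrite andbF.
by rewrite -sum1_card [RHS]big_mkcond; apply: eq_bigr => v _; rewrite andbT.
Qed.

(** Incidences between points and boxes are counted in two ways. *)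
Lemma volume d k (T : seq (sides_of d)) : covers k T ->
  \sum_(S <- T) \prod_(i < d) #|S i| = k * 3 ^ d.
Proof.
case=> _ T_count; transitivity (\sum_(S <- T) \sum_(x : point d) (x \in box S)).
  apply: eq_bigr => S _; transitivity #|family (fun i => mem (S i))|.
    by rewrite card_family foldrE big_map big_enum.
  rewrite -sum1_card [LHS]big_mkcond; apply: eq_bigr => x _.
  by rewrite !inE.
rewrite exchange_big (eq_bigr (fun=> k)) => [|x _].
  by rewrite sum_nat_const card_ffun !card_ord mulnC.
by rewrite -count_sum; apply: T_count.
Qed.

(** * Slices and coslices *)

Definition drop_side d (i : 'I_d.+1) (S : sides_of d.+1) :
  sides_of d := [ffun j => S (lift i j)].

Definition insert_coord d (i : 'I_d.+1) (v : 'I_3) (x : point d) : point d.+1 :=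
  [ffun j => if unlift i j is Some j' then x j' else v].

Lemma in_insert_coord d (i : 'I_d.+1) v (x : point d) (S : sides_of d.+1) :
  (insert_coord i v x \in box S) = (v \in S i) && (x \in box (drop_side i S)).
Proof.
rewrite !inE; apply/forallP/andP => [xS | [vS /forallP xS] j].
  split; first by have := xS i; rewrite ffunE unlift_none.
  by apply/forallP => j; have := xS (lift i j); rewrite !ffunE liftK.
rewrite ffunE; case: unliftP => [j'|] -> //.
by have := xS j'; rewrite ffunE.
Qed.

Lemma drop_side_proper d (i : 'I_d.+1) (S : sides_of d.+1) :
  proper_sides S -> proper_sides (drop_side i S).
Proof. by move=> /forallP Sp; apply/forallP => j; rewrite ffunE. Qed.

Lemma covers_slice d k (i : 'I_d.+1) v (T : seq (sides_of d.+1)) : covers k T ->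
  covers k [seq drop_side i U | U : sides_of d.+1 <- T & v \in U i].
Proof.
case=> T_proper T_count; split=> [|x].
  rewrite all_map all_filter; apply: sub_all T_proper => S Sp /=.
  by apply/implyP => _; apply: drop_side_proper.
rewrite -(T_count (insert_coord i v x)) /cover_mult count_map count_filter.
by apply: eq_count => S /=; rewrite in_insert_coord andbC.
Qed.

Lemma sum_card_side d (i : 'I_d) (T : seq (sides_of d)) : all (@proper_sides d) T ->
  count (fun S : sides_of d => #|S i| == 1) T + \sum_(S <- T) #|S i| = 2 * size T.
Proof.
move=> /allP T_proper.
rewrite count_sum -big_split -sum1_size big_distrr /= big_seq [RHS]big_seq.
apply: eq_bigr => S ST; rewrite addnC card_proper_side //.
by have /forallP := T_proper S ST.
Qed.

(** A box enters as many slices as its side has elements, and each of the three slices has at least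
    [f d] boxes. *)
Lemma f_slice_le d (i : 'I_d.+1) (T : seq (sides_of d.+1)) : covers 2 T ->
  count (fun S : sides_of d.+1 => #|S i| == 1) T + 3 * f d <= 2 * size T.
Proof.
move=> T2; have [/(sum_card_side i) <- _] := T2.
have -> : 3 * f d = \sum_(v : 'I_3) f d by rewrite sum_nat_const card_ord.
rewrite leq_add2l -(sum_count_side xpredT).
apply: leq_sum => v _; apply: leq_trans (f_le (covers_slice i v T2)) _.
by rewrite size_map size_filter; apply: sub_count => S /= ->.
Qed.

(* If all sides in direction [i] have two elements, then every point of the
   quotient is in 3 projected boxes, exactly one of which misses the value [v]. *)
Lemma covers_coslice d (i : 'I_d.+1) v (T : seq (sides_of d.+1)) : covers 2 T ->
  count (fun S : sides_of d.+1 => #|S i| == 1) T = 0 ->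
  covers 1 [seq drop_side i U | U : sides_of d.+1 <- T & v \notin U i].
Proof.
move=> T2 /eqP; rewrite eqn0Ngt -has_count => /hasPn T_two.
have [T_proper T_count] := T2; split=> [|x].
  rewrite all_map all_filter; apply: sub_all T_proper => S Sp /=.
  by apply/implyP => _; apply: drop_side_proper.
have slice2 u :
    count (fun S : sides_of d.+1 => (u \in S i) && (x \in box (drop_side i S))) T = 2.
  transitivity (cover_mult T (insert_coord i u x)); last exact: T_count.
  by apply: eq_count => S /=; rewrite in_insert_coord.
(* Three slices of multiplicity 2 make 6 incidences, two for each projected box through [x]. So
   there are 3 such boxes, and the 2 containing [v] leave one. *)
have := sum_count_side (fun S => x \in box (drop_side i S)) i T.
rewrite (eq_bigr _ (fun u _ => slice2 u)) sum_nat_const card_ord.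
have -> : \sum_(S <- T | x \in box (drop_side i S)) #|S i| =
    2 * count (fun S => x \in box (drop_side i S)) T.
  rewrite -sum1_count big_distrr /= big_seq_cond [RHS]big_seq_cond.
  apply: eq_bigr => S /andP[ST _].
  have /forallP/(_ i)/card_proper_side := allP T_proper S ST.
  by rewrite (negbTE (T_two S ST)) addn0.
have := slice2 v; rewrite /cover_mult count_map count_filter.
have -> : count (fun S => x \in box (drop_side i S)) T =
    count (fun S : sides_of d.+1 => (v \in S i) && (x \in box (drop_side i S))) T +
    count (fun S : sides_of d.+1 => (x \in box (drop_side i S)) && (v \notin S i)) T.
  rewrite !count_sum -big_split; apply: eq_bigr => S _ /=.
  by case: (v \in S i); case: (x \in _).
by move=> ->; set c := count _ T => N6; rewrite -[LHS]/c; lia.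
Qed.

Lemma covers_volume_le d k (T : seq (sides_of d)) : covers k T ->
  k * 3 ^ d <= size T * 2 ^ d.
Proof.
move=> Tk; rewrite -(volume Tk) -sum1_size big_distrl /= big_seq [X in _ <= X]big_seq.
apply: leq_sum => S ST; rewrite mul1n -[X in 2 ^ X]card_ord -prod_nat_const.
apply: leq_prod => i _; have [/allP/(_ S ST)/forallP/(_ i) S_proper _] := Tk.
exact: leq_trans (leq_addr _ _) (eq_leq (card_proper_side S_proper)).
Qed.

(** * Lower bounds in dimensions 1, 2 and 3 *)

Lemma f1_ge : 3 <= f 1.
Proof. by have [T /covers_volume_le vol_le <-] := f_witness 1; lia. Qed.

(** If [size T <= 5], slices force size 5 and [s i <= 1], and coslices force [s i = 1]. The volume
    then gives [s2 = 2], against [s2 <= s ord0]. *)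
Lemma f2_ge : 6 <= f 2.
Proof.
have [T T2 <-] := f_witness 2; rewrite leqNgt; apply/negP => T_small.
pose s i := count (fun S : sides_of 2 => #|S i| == 1) T.
have s_le i : s i + 9 <= 2 * size T.
  by have := f_slice_le i T2; have := f1_ge; rewrite -/(s i); lia.
have s_gt0 i : 0 < s i.
  rewrite lt0n; apply/negP => /eqP si0; move: T_small; rewrite ltnNge => /negP; apply.
  have coslice_ge v : 2 <= count (fun S : sides_of 2 => v \notin S i) T.
    have := covers_volume_le (covers_coslice v T2 si0).
    by rewrite size_map size_filter; lia.
  (* Each box misses exactly one value in direction [i], so it is counted once. *)
  have sum_coslice : \sum_(v : 'I_3) count (fun S : sides_of 2 => v \notin S i) T = size T.
    under eq_bigr => v _ do rewrite count_sum.
    rewrite exchange_big -sum1_size big_seq [RHS]big_seq; apply: eq_bigr => S ST.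
    have [/allP/(_ S ST)/forallP/(_ i) S_side _] := T2.
    have /hasPn/(_ S ST) S_two : ~~ has (fun S : sides_of 2 => #|S i| == 1) T.
      by rewrite has_count -eqn0Ngt -/(s i) si0.
    rewrite [RHS](_ : _ = #|~: S i|); last by rewrite card_setC_proper_side.
    by rewrite -sum1_card [RHS]big_mkcond; apply: eq_bigr => v _; rewrite inE.
  rewrite -sum_coslice; apply: leq_trans (leq_sum _ (fun v _ => coslice_ge v)).
  by rewrite sum_nat_const card_ord.
pose s2 := count (fun S : sides_of 2 => (#|S ord0| == 1) && (#|S ord_max| == 1)) T.
have s2_le : s2 <= s ord0 by apply: sub_count => S /andP[].
(* Sum over the boxes of (2 - a)(2 - b) = 4 - 2a - 2b + ab, where a and b indicate one-element
   sides. *)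
have vol : 18 + 2 * (s ord0 + s ord_max) = 4 * size T + s2.
  rewrite -[18]/(2 * 3 ^ 2) -(volume T2) /s /s2 !count_sum -sum1_size.
  rewrite -big_split !big_distrr -!big_split /= big_seq [RHS]big_seq.
  apply: eq_bigr => S ST; have [/allP/(_ S ST)/forallP S_proper _] := T2.
  rewrite big_ord_recl big_ord1 (_ : lift ord0 ord0 = ord_max); last exact: val_inj.
  have := card_proper_side (S_proper ord0); have := card_proper_side (S_proper ord_max).
  by case: #|_| => [|[|[|]]] //; case: #|_| => [|[|[|]]].
have := s_le ord0; have := s_le ord_max; have := s_gt0 ord0; have := s_gt0 ord_max.
lia.
Qed.

(** With m boxes, slices give [\sum_i s i <= 6m - 54]; inserted in the volume bound, this yields 16m
    >= 162. *)
Lemma f3_ge : 11 <= f 3.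
Proof.
have [T T2 <-] := f_witness 3.
pose s i := count (fun S : sides_of 3 => #|S i| == 1) T.
have s_le i : s i + 18 <= 2 * size T.
  by have := f_slice_le i T2; have := f2_ge; rewrite -/(s i); lia.
(* Each box satisfies [8 <= \prod_i (2 - b i) + 4 * \sum_i b i], with equality when at most one side
   is a singleton. *)
have vol : 8 * size T <= 54 + 4 * \sum_i s i.
  have -> : \sum_i s i = \sum_(S <- T) \sum_i (#|S i| == 1).
    by rewrite exchange_big; apply: eq_bigr => i _; apply: count_sum.
  rewrite -[54]/(2 * 3 ^ 3) -(volume T2) -sum1_size.
  rewrite !big_distrr -big_split /= big_seq [X in _ <= X]big_seq.
  apply: leq_sum => S ST; have [/allP/(_ S ST)/forallP S_proper _] := T2.
  pose b i := #|S i| == 1.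
  rewrite (eq_bigr (fun i => 2 - b i)) => [|i _]; last first.
    by rewrite /b; have := card_proper_side (S_proper i); case: #|_| => [|[|[|]]].
  rewrite [X in 4 * X](_ : _ = \sum_i b i) // !big_ord_recl !big_ord0.
  by do 3!case: (b _).
have : \sum_i s i + 3 * 18 <= 3 * (2 * size T).
  have := leq_sum (index_enum _) (fun i (_ : true) => s_le i).
  by rewrite big_split !sum_nat_const card_ord.
lia.
Qed.

(* Asymptotics and the final statement *)
From mathcomp Require Import all_order all_algebra.
From mathcomp Require Import all_classical all_reals all_analysis.
From mathcomp Require Import lra.
Import Order.TTheory GRing.Theory Num.Theory.
Import numFieldNormedType.Exports.
Local Open Scope classical_set_scope.
Local Open Scope ring_scope.

(** For g(d) = f(d) / 2^d the leapfrog reads g(d + 3) <= 3/4 + 3/8 g(d), with fixed point 6/5. The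
    excess shrinks by 3/8 every three steps, and 3/8 <= (3/4)^3. *)
Lemma f_le_asymptotic (R : realType) d :
  (f d)%:R <= (6%:R / 5%:R + (3%:R / 4%:R) ^+ d) * 2%:R ^+ d :> R.
Proof.
elim/ltn_ind: d => d IHd.
case: d IHd => [|[|[|d]]] IHd.
- by have := f0_le; rewrite -(ler_nat R) !expr0; lra.
- by have := f1_le; rewrite -(ler_nat R) !expr1; lra.
- by have := f_lift2 0; have := f0_le; rewrite -(ler_nat R) -(ler_nat R (f _)) natrD natrM; lra.
have := f_leapfrog d; rewrite addn3 -(ler_nat R) natrD !natrM natrX => f_le.
apply: le_trans f_le _; have := IHd d (ltn_addl 2 (ltnSn d)).
rewrite !exprS; have x_ge0 : 0 <= 2%:R ^+ d :> R by rewrite exprn_ge0.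
have y_ge0 : 0 <= (3%:R / 4%:R) ^+ d :> R by rewrite exprn_ge0 // divr_ge0.
by have := mulr_ge0 y_ge0 x_ge0; lra.
Qed.

Theorem mainTheorem8 (R : realType) :
  (* small values and their agreement with the closed form *)
  [/\ f 2 = 6%N, f 3 = 11%N, (f 4 <= 21)%N & (f 5 <= 41)%N]
  /\ [/\ closed_form 2 = 6%N, closed_form 3 = 11%N,
         closed_form 4 = 21%N & closed_form 5 = 41%N]
  (* lifting inequality *)
  /\ (forall r : nat, (f (r + 3) <= 6 * 2 ^ r + 3 * f r)%N)
  (* failure at d = 7, and from d = 7 on *)
  /\ [/\ (f 7 <= 6 * 2 ^ 4 + 3 * 21)%N, (6 * 2 ^ 4 + 3 * 21 = 159)%N,
         (159 < 161)%N, (161 = 5 * 2 ^ 5 + 1)%N & closed_form 7 = 161%N]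
  /\ (forall d : nat, (7 <= d)%N -> (f d < closed_form d)%N)
  (* f(d) <= (6/5 + o(1)) 2^d, which is eventually below 5/4 * 2^d *)
  /\ (exists u : nat -> R,
        [/\ u @ \oo --> (0 : R),
            forall d : nat, (f d)%:R <= (6%:R / 5%:R + u d) * 2%:R ^+ d
          & \forall d \near \oo,
              (6%:R / 5%:R + u d) * 2%:R ^+ d < 5%:R / 4%:R * 2%:R ^+ d])
  (* the closed form bounds f for 2 <= d <= 6 *)
  /\ (forall d : nat, (2 <= d <= 6)%N -> (f d <= closed_form d)%N).
Proof.
have f2E : f 2 = 6%N by have : (f 2 <= _)%N := f_lift2 0; have := f0_le; have := f2_ge; lia.
have f3E : f 3 = 11%N by have : (f 3 <= _)%N := f_lift2 1; have := f1_le; have := f3_ge; lia.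
split; first by split; [| | exact: f4_le | exact: f5_le].
split; first by [].
split; first exact: f_leapfrog.
split.
  split=> //; apply: leq_trans (f_leapfrog 4) _.
  by rewrite leq_add2l leq_mul2l f4_le.
split; first exact: f_lt_closed_form.
split.
  have cvg_u : (fun d => (3%:R / 4%:R : R) ^+ d) @ \oo --> (0 : R).
    by apply: cvg_expr; rewrite ger0_norm; lra.
  exists (fun d => (3%:R / 4%:R) ^+ d); split=> //; first exact: f_le_asymptotic.
  (* 1/20 is the gap 5/4 - 6/5. *)
  have e_gt0 : (0 : R) < 20%:R^-1 by rewrite invr_gt0 ltr0n.
  near=> d; rewrite ltr_pM2r ?exprn_gt0 ?ltr0n //.
  suff : (3%:R / 4%:R : R) ^+ d < 20%:R^-1 by lra.
  by near: d; apply: cvgr_lt cvg_u _ e_gt0.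
move=> d /andP[le2d led6].
have : d \in [:: 2; 3; 4; 5; 6]%N by rewrite !inE; lia.
rewrite !inE; do 4?case/orP; move/eqP->.
- by rewrite f2E.
- by rewrite f3E.
- exact: f4_le.
- exact: f5_le.
- exact: f6_le.
Unshelve. all: by end_near.
Qed.
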